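(* Let $D\ge 1$, $\alpha\ge 1$ and $\beta>0$ be constants. There is a constant $c>0$, depending only on $D,\alpha,\beta$, such that the following holds. Let $H=-\sum_{a=1}^M G_a$ be a local frustration-free stabilizer Hamiltonian on the $D$-dimensional periodic lattice $\Lambda=\mathbb{Z}_L^D$ which obeys both topological order conditions with length scale $L_{tqo}\ge L^\beta$ and obeys the no-strings rule with constant $\alpha$. Then the energy barrier for any logical operator $\overline{P}$ is at least $c\log L$; that is, for every error path $E_1,\dots,E_T$ (of arbitrary finite length $T$) implementing $\overline{P}$, at least one of the intermediate states $\psi(t)=E_t\cdots E_1\psi_0$ has more than $c\log L$ defects.
   Context: **Lattice.** $\Lambda=\mathbb{Z}_L^D$ is the cubic lattice of linear size $L$ with periodic boundary conditions, with a finite number of qubits at each site; distances and diameters use the $\ell_\infty$ metric. An axis-parallel cube of linear size $\ell$ is a product of $D$ intervals of $\ell$ consecutive coordinates (so $\Lambda$ has linear size $L$). An elementary cube is a unit cell of the lattice (its $2^D$ vertices); it has diameter $1$. $\mathcal{B}_r(A)$ is the set of all points at distance at most $r$ from $A$. **Stabilizer Hamiltonian.** $H=-\sum_{a=1}^M G_a$, where the $G_a$ are pairwise commuting multi-qubit Pauli operators (tensor products of $I,X,Y,Z$ with sign $\pm1$), $G_a^2=I$, each acting non-trivially only on qubits at the vertices of one elementary cube (several generators per cube are allowed). No translation invariance is assumed. $\mathcal{G}=\langle G_1,\dots,G_M\rangle$ is the stabilizer group; its elements are stabilizers. Frustration-freeness: $-I\notin\mathcal{G}$, so ground states (the ''vacuum'')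 $\psi_0$ satisfy $G_a\psi_0=\psi_0$ for all $a$. The support of a Pauli operator is the set of sites/qubits on which it acts non-trivially. For a Pauli operator $E$, the defects of $E\psi_0$ (created by applying $E$ to the vacuum) are the generators $G_a$ anticommuting with $E$; each defect is located at the elementary cube of its generator. A logical operator is a Pauli operator $E$ commuting with all of $\mathcal{G}$ but not in $\mathcal{G}$ (up to phase). **Topological order (length scale $L_{tqo}$).** (1) If a Pauli operator $E$ creates no defects when applied to the vacuum and its support can be enclosed by a cube of linear size $L_{tqo}$, then $E$ is a stabilizer. (2) A cluster (set) of defects $S$ is *neutral* if it can be created from the vacuum, without any other defects, by a Pauli operator whose support can be enclosed by a cube of linear size $L_{tqo}$; otherwise $S$ is *charged*. The condition: if $S$ is neutral and $C_{min}(S)$ is the smallest cube enclosing $S$, then $S$ can be created from the vacuum by a Pauli operator supported on $\mathcal{B}_1(C_{min}(S))$. **No-strings rule (constant $\alpha$).** Let $E$ be a Pauli operator whose support can be enclosed by a cube of linear size $L_{tqo}$, let $S$ be the cluster of defects it creates from the vacuum, and let $A_1,A_2$ be disjoint cubes of the same linear size $\rho$. $E$ is a *logical string segment* with anchor regions $A_1,A_2$ iff $S$ is contained in $A_1\cup A_2$ (equivalently $E$ commutes with all generators located outside $A_1\cup A_2$). It has aspect ratio $\alpha'$ iff the distance between $A_1$ and $A_2$ is at least $\alpha'\rho$. It is *trivial* iff the cluster of defects contained inside any anchor region is neutral. The rule: all logical string segments with aspect ratio greater than $\alpha$ are trivial. **Error path and energy barrier.** An error path implementing a Pauli operator $P$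 is a finite sequence $E_1,\dots,E_T$ of single-qubit Pauli operators ($X$, $Y$ or $Z$ on one qubit; repetitions allowed) with $P=E_T\cdots E_1$. The intermediate states are $\psi(t)=E_t\cdots E_1\psi_0$, with $\psi_0$ a ground state (the defects do not depend on the choice of $\psi_0$). $P$ has energy barrier $\omega$ iff for every error path implementing $P$ at least one intermediate state has more than $\omega$ defects. *)

(* Defs.v *)
From HB Require Import structures.
From mathcomp Require Import all_boot all_order all_algebra all_fingroup.
From mathcomp Require Import reals exp.

Set Implicit Arguments.
Unset Strict Implicit.
Unset Printing Implicit Defensive.

Import GroupScope.

Inductive letter := PI | PX | PY | PZ.

Definition letter_code (s : letter) : bool * bool :=
  match s with
  | PI => (false, false) | PX => (true, false)
  | PY => (true, true)   | PZ => (false, true)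
  end.

Definition letter_decode (b : bool * bool) : letter :=
  match b with
  | (false, false) => PI | (true, false) => PX
  | (true, true) => PY   | (false, true) => PZ
  end.

Lemma letter_codeK : cancel letter_code letter_decode.
Proof. by case. Qed.

HB.instance Definition _ := Finite.copy letter (can_type letter_codeK).

(* The 2 x 2 matrices satisfy s * t = i ^ (letter_phase s t) (letter_mul s t),
   see letter_mxM. *)
Definition letter_mul (s t : letter) : letter :=
  match s, t with
  | PI, u | u, PI => u
  | PX, PX | PY, PY | PZ, PZ => PI
  | PX, PY | PY, PX => PZ
  | PY, PZ | PZ, PY => PX
  | PZ, PX | PX, PZ => PY
  end.

Definition letter_phase (s t : letter) : 'Z_4 :=
  match s, t with
  | PX, PY | PY, PZ | PZ, PX => 1%R
  | PY, PX | PZ, PY | PX, PZ => (- 1)%R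
  | _, _ => 0%R
  end.

Section LetterMatrix.
Import GRing.Theory Num.Theory.
Local Open Scope ring_scope.
Variable C : numClosedFieldType.

Definition letter_mx (s : letter) : 'M[C]_2 :=
  \matrix_(i, j)
    match s with
    | PI => (i == j)%:R
    | PX => (i != j)%:R
    | PY => if i == j then 0 else if i == 0 then - 'i else 'i
    | PZ => if i == j then (-1) ^+ i else 0
    end.

Lemma letter_mxM s t :
  letter_mx s *m letter_mx t
  = 'i ^+ (letter_phase s t : nat) *: letter_mx (letter_mul s t).
Proof.
have i2 : ('i : C) * 'i = -1 by rewrite -expr2 sqrCi.
have i3 : ('i : C) ^+ 3 = - 'i by rewrite !exprS expr0 mulr1 i2 mulrN1.
by apply/matrixP => -[[|[|//]] ?] [[|[|//]] ?];
  rewrite !mxE !big_ord_recl big_ord0 !mxE; case: s; case: t => /=;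
  rewrite ?i3 ?(expr0, expr1, mul0r, mulr0, mul1r, mulr1, add0r, addr0,
    mulrN, mulNr, opprK, i2, mulrN1, mulN1r, oppr0).
Qed.

End LetterMatrix.

Section PauliGroup.
Variable Q : finType.

(* [Pauli k f] is the operator i ^ k (tensor product over q of f q). *)
Record pauli := Pauli { phase : 'Z_4; letters : {ffun Q -> letter} }.

Definition pauli_code (P : pauli) := (phase P, letters P).
Definition pauli_decode (u : 'Z_4 * {ffun Q -> letter}) := Pauli u.1 u.2.

Lemma pauli_codeK : cancel pauli_code pauli_decode.
Proof. by case. Qed.

HB.instance Definition _ := Finite.copy pauli (can_type pauli_codeK).

Definition pauli_mul (P R : pauli) : pauli :=
  Pauli (phase P + phase R + \sum_q letter_phase (letters P q) (letters R q))%R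
        [ffun q => letter_mul (letters P q) (letters R q)].

Definition pauli_scalar (k : 'Z_4) : pauli := Pauli k [ffun=> PI].

Definition pauli_inv (P : pauli) : pauli := Pauli (- phase P)%R (letters P).

Lemma letter_mulA : associative letter_mul.
Proof. by case; case; case. Qed.

Lemma letter_phaseA s t u :
  (letter_phase t u + letter_phase s (letter_mul t u)
   = letter_phase s t + letter_phase (letter_mul s t) u)%R.
Proof. by apply/eqP; case: s; case: t; case: u. Qed.

Lemma pauli_mulA : associative pauli_mul.
Proof.
move=> [k f] [l g] [m h]; rewrite /pauli_mul /=; congr Pauli; last first.
  by apply/ffunP => q; rewrite !ffunE letter_mulA.
rewrite !GRing.addrA -!GRing.addrA; congr (_ + (_ + _))%R.
rewrite [RHS]GRing.addrCA; congr (_ + _)%R; rewrite -!big_split /=.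
by apply: eq_bigr => q _; rewrite !ffunE letter_phaseA.
Qed.

Lemma pauli_mul1 : left_id (pauli_scalar 0%R) pauli_mul.
Proof.
move=> [k f]; rewrite /pauli_mul /= GRing.add0r; congr Pauli; last first.
  by apply/ffunP => q; rewrite !ffunE; case: (f q).
by rewrite big1 ?GRing.addr0 // => q _; rewrite !ffunE; case: (f q).
Qed.

Lemma pauli_mulV : left_inverse (pauli_scalar 0%R) pauli_inv pauli_mul.
Proof.
move=> [k f]; rewrite /pauli_mul /= GRing.addNr GRing.add0r.
congr Pauli; last by apply/ffunP => q; rewrite !ffunE; case: (f q).
by rewrite big1 // => q _; case: (f q).
Qed.

HB.instance Definition _ :=
  Finite_isGroup.Build pauli pauli_mulA pauli_mul1 pauli_mulV.

Definition anticommute (P R : pauli) : bool :=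
  P * R == pauli_scalar 2%R * (R * P).

Definition single_qubit (E : pauli) : Prop :=
  exists (q : Q) (s : letter),
    s <> PI /\ E = Pauli 0%R [ffun q' => if q' == q then s else PI].

(* E_t ... E_1, where [path] lists E_1, ..., E_T in this order. *)
Definition path_op (path : seq pauli) (t : nat) : pauli :=
  foldl (fun P E => E * P) 1 (take t path).

Definition error_path (path : seq pauli) (P : pauli) : Prop :=
  (forall E, E \in path -> single_qubit E) /\ path_op path (size path) = P.

End PauliGroup.

Section Lattice.
Variables D L : nat.

Definition site := {ffun 'I_D -> 'I_L}.

Definition coord_dist (x y : 'I_L) : nat :=
  let d := (x - y) + (y - x) in minn d (L - d).

Definition dist (x y : site) : nat := \max_(i < D) coord_dist (x i) (y i).

Definition ball (r : nat) (A : {set site}) : {set site} :=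
  [set y | [exists x in A, dist x y <= r]].

(* For l >= L the l consecutive coordinates wrap around: the cube is the whole
   lattice. *)
Definition cube (a : site) (l : nat) : {set site} :=
  [set x : site | [forall i : 'I_D, exists k : 'I_l,
                     x i == a i + k %[mod L]]].

Definition elementary_cube (a : site) : {set site} := cube a 2.

End Lattice.

Record stabilizer_hamiltonian (D L : nat) := StabilizerHamiltonian {
  qubit : finType;
  qubit_site : qubit -> site D L;
  nterm : nat;
  term : 'I_nterm -> pauli qubit;
  (* the vertex a of the elementary cube a + {0,1}^D carrying the term *)
  term_cell : 'I_nterm -> site D L;
  term_commute : forall a b, commute (term a) (term b);
  (* forces the phase to be +1 or -1, see pauli_squareP *)
  term_square : forall a, term a * term a = 1;
  term_local : forall (a : 'I_nterm) (q : qubit), letters (term a) q <> PI ->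
    qubit_site q \in elementary_cube (term_cell a);
  frustration_free :
    pauli_scalar qubit 2%R \notin <<[set term a | a : 'I_nterm]>>
}.

Lemma pauli_squareP (Q : finType) (P : pauli Q) :
  reflect (phase P = 0%R \/ phase P = 2%R) (P * P == 1).
Proof.
have -> : (P * P == 1) = (phase P + phase P == 0)%R.
  apply/eqP/eqP => [/(congr1 (@phase Q))|h] /=.
    by rewrite big1 ?GRing.addr0 // => q _; case: (letters P q).
  change (pauli_mul P P = pauli_scalar Q 0%R).
  rewrite /pauli_mul h; congr Pauli.
    by rewrite big1 ?GRing.addr0 // => q _; case: (letters P q).
  by apply/ffunP => q; rewrite !ffunE; case: (letters P q).
apply: (iffP eqP) => [|[->|->]]; [|by apply/eqP|by apply/eqP].
case: (phase P) => [[|[|[|[|//]]]] hm] /eqP // _; first by left; apply/eqP.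
by right; apply/eqP.
Qed.

Section StabilizerCode.
Variables (D L : nat) (H : stabilizer_hamiltonian D L).
Local Notation operator := (pauli (qubit H)).
Local Notation cluster := {set 'I_(nterm H)}.

Definition stabilizer_group : {set operator} :=
  <<[set term a | a : 'I_(nterm H)]>>.

(* The phase matters: pauli_scalar k creates no defects for any k, but only
   k = 0 gives an element of the group. *)
Definition stabilizer_up_to_phase (E : operator) : Prop :=
  exists k : 'Z_4, pauli_scalar (qubit H) k * E \in stabilizer_group.

Definition logical_operator (E : operator) : Prop :=
  (forall P, P \in stabilizer_group -> commute E P)
  /\ ~ stabilizer_up_to_phase E.

Definition support (E : operator) : {set site D L} :=
  [set qubit_site q | q : qubit H & letters E q != PI].

(* G_a E psi_0 = - E psi_0 for a ground state psi_0 iff G_a anticommutes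
   with E. *)
Definition defects (E : operator) : cluster :=
  [set a | anticommute (term a) E].

Definition cluster_region (S : cluster) : {set site D L} :=
  \bigcup_(a in S) elementary_cube (term_cell a).

Definition defects_inside (S : cluster) (A : {set site D L}) : cluster :=
  [set a in S | elementary_cube (term_cell a) \subset A].

Definition enclosable (A : {set site D L}) (l : nat) : Prop :=
  exists a : site D L, A \subset cube a l.

Definition neutral (Ltqo : nat) (S : cluster) : Prop :=
  exists E : operator, enclosable (support E) Ltqo /\ defects E = S.

Definition smallest_cube (S : cluster) (a : site D L) (l : nat) : Prop :=
  cluster_region S \subset cube a l
  /\ forall l', enclosable (cluster_region S) l' -> l <= l'.

Definition tqo_local_stabilizer (Ltqo : nat) : Prop :=
  forall E : operator, defects E = set0 -> enclosable (support E) Ltqo ->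
  stabilizer_up_to_phase E.

(* A smallest enclosing cube need not be unique; the condition is imposed for
   one of them only, hence is implied by any choice of C_min(S). *)
Definition tqo_neutral_cluster (Ltqo : nat) : Prop :=
  forall S : cluster, neutral Ltqo S ->
  exists (a : site D L) (l : nat) (E : operator),
    [/\ smallest_cube S a l, defects E = S
      & support E \subset ball 1 (cube a l)].

Definition string_segment (Ltqo : nat) (E : operator) (a1 a2 : site D L)
    (rho : nat) : Prop :=
  [/\ enclosable (support E) Ltqo, [disjoint cube a1 rho & cube a2 rho]
    & cluster_region (defects E) \subset cube a1 rho :|: cube a2 rho].

Definition trivial_segment (Ltqo : nat) (E : operator) (a1 a2 : site D L)
    (rho : nat) : Prop :=
  neutral Ltqo (defects_inside (defects E) (cube a1 rho))
  /\ neutral Ltqo (defects_inside (defects E) (cube a2 rho)).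

Section Real.
Variable R : realType.
Local Open Scope ring_scope.

Definition has_aspect_ratio (alpha' : R) (a1 a2 : site D L) (rho : nat) :=
  forall x y, x \in cube a1 rho -> y \in cube a2 rho ->
  alpha' * rho%:R <= (dist x y)%:R.

Definition no_strings (Ltqo : nat) (alpha : R) : Prop :=
  forall (E : operator) (a1 a2 : site D L) (rho : nat) (alpha' : R),
    string_segment Ltqo E a1 a2 rho -> has_aspect_ratio alpha' a1 a2 rho ->
    alpha < alpha' -> trivial_segment Ltqo E a1 a2 rho.

Definition energy_barrier (P : operator) (omega : R) : Prop :=
  forall path : seq operator, error_path path P ->
  exists t : nat, (1 <= t <= size path)%N
    /\ omega < #|defects (path_op path t)|%:R.

End Real.

End StabilizerCode.

(* Main.v *)
(* Work modulo stabilizers, and call a set of defects sparse at scale xi if it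
   splits into clusters of diameter at most xi separated by a large multiple of
   xi. Consider a stretch of the error path whose intermediate states are all
   sparse at scale xi and whose steps are localized within xi of the defects at
   their endpoints. Neutral clusters can be removed locally, and by the
   no-strings rule the remaining charged clusters cannot drift by more than a
   constant times xi; hence the whole stretch is equivalent to an operator
   localized within a constant times xi of the defects at its two ends. So the
   stretch can be contracted to a single step at a scale larger by a constant
   factor. A set of m defects cannot fail to be sparse at m successive scales, so
   if no state has more than m defects, then after m contractions the path is one
   localized step from the vacuum to the vacuum, that is, a stabilizer. This only
   requires K ^ m <= L_tqo for a constant K. *)

Require Import Defs.
From mathcomp Require Import all_boot all_order all_algebra all_fingroup.
From HB Require Import structures.
From mathcomp Require Import boolp reals exp zify.

Set Implicit Arguments.
Unset Strict Implicit.
Unset Printing Implicit Defensive.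

Import Order.TTheory GRing.Theory Num.Theory.

(** * Renormalization on a finite metric space *)

Section Core.

Variables (X T Q : finType) (dist : X -> X -> nat).
Hypothesis distxx : forall x, dist x x = 0.
Hypothesis distC : forall x y, dist x y = dist y x.
Hypothesis dist_tri : forall x y z, dist x z <= dist x y + dist y z.

(** Intended reading: [Q] are the qubits, [T] the generators, and an [op] is a Pauli operator modulo
    phase, written additively. [syn a u] says that [u] anticommutes with the generator [a]. *)
Variables (loc : Q -> X) (cell : T -> X) (G : zmodType).
Local Notation op := {ffun Q -> G}.
Implicit Types (u v w f g h : op) (A B W Y : {set X}) (S : {set T}).

Variable syn : T -> op -> bool.
Hypothesis syn_sub : forall a u v, syn a (u - v)%R = syn a u (+) syn a v.
Hypothesis syn_local : forall a u, syn a u ->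
  exists2 q, u q != 0%R & dist (cell a) (loc q) <= 1.

Variable stab : op -> Prop.
Hypothesis stab0 : stab 0%R.
Hypothesis stab_sub : forall u v, stab u -> stab v -> stab (u - v)%R.
Hypothesis syn_stab : forall a u, stab u -> syn a u = false.

Definition syndrome u : {set T} := [set a | syn a u].
Definition positions u : {set X} := cell @: syndrome u.

Definition supported A r u : Prop :=
  forall q, u q != 0%R -> exists2 x, x \in A & dist x (loc q) <= r.

Definition equiv u v : Prop := stab (u - v)%R.

Lemma stabN u : stab u -> stab (- u)%R.
Proof. by move=> su; rewrite -sub0r; apply: stab_sub. Qed.

Lemma stabD u v : stab u -> stab v -> stab (u + v)%R.
Proof. by move=> su sv; rewrite -[v]opprK; apply: stab_sub => //; apply: stabN. Qed.

Lemma equivxx u : equiv u u.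
Proof. by rewrite /equiv subrr. Qed.

Lemma equiv_trans v u w : equiv u v -> equiv v w -> equiv u w.
Proof. by move=> uv vw; rewrite /equiv -(subrKA v); apply: stabD. Qed.

Lemma equivD u u' v v' : equiv u u' -> equiv v v' -> equiv (u + v)%R (u' + v')%R.
Proof. by move=> uu vv; rewrite /equiv opprD addrACA; apply: stabD. Qed.

Lemma equivN u v : equiv u v -> equiv (- u)%R (- v)%R.
Proof. by move=> uv; rewrite /equiv -opprD; apply: stabN. Qed.

Lemma equivB u u' v v' : equiv u u' -> equiv v v' -> equiv (u - v)%R (u' - v')%R.
Proof. by move=> uu vv; apply: equivD => //; apply: equivN. Qed.

Lemma syn0 a : syn a 0%R = false.
Proof. exact: syn_stab. Qed.

Lemma synN a u : syn a (- u)%R = syn a u.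
Proof. by rewrite -sub0r syn_sub syn0. Qed.

Lemma synD a u v : syn a (u + v)%R = syn a u (+) syn a v.
Proof. by rewrite -[v]opprK syn_sub synN opprK. Qed.

Lemma syn_equiv a u v : equiv u v -> syn a u = syn a v.
Proof. by move=> /(syn_stab a); rewrite syn_sub; case: syn; case: syn. Qed.

Lemma mem_positions u a : syn a u -> cell a \in positions u.
Proof. by move=> au; apply: imset_f; rewrite inE. Qed.

Lemma positionsP u x : reflect (exists2 a, syn a u & x = cell a) (x \in positions u).
Proof.
apply: (iffP imsetP) => [[a]|[a au ->]]; first by rewrite inE; exists a.
by exists a; rewrite ?inE.
Qed.

Lemma supported0 A r : supported A r 0%R.
Proof. by move=> q; rewrite ffunE eqxx. Qed.

Lemma supportedN A r u : supported A r u -> supported A r (- u)%R.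
Proof. by move=> Au q; rewrite ffunE oppr_eq0; apply: Au. Qed.

Lemma supportedD A r u v :
  supported A r u -> supported A r v -> supported A r (u + v)%R.
Proof.
move=> Au Av q; rewrite ffunE => uv.
have [u0|] := eqVneq (u q) 0%R; last exact: Au.
by apply: Av; rewrite u0 add0r in uv.
Qed.

Lemma supportedB A r u v :
  supported A r u -> supported A r v -> supported A r (u - v)%R.
Proof. by move=> Au Av; apply: supportedD => //; apply: supportedN. Qed.

Lemma supported_widen A B r s t u :
  (forall x, x \in A -> exists2 y, y \in B & dist y x <= t) -> t + r <= s ->
  supported A r u -> supported B s u.
Proof.
move=> AB trs Au q /Au[x /AB[y By yx] xq]; exists y => //.
by have := dist_tri y x (loc q); lia.
Qed.

Lemma supported_sub A B r s u :
  A \subset B -> r <= s -> supported A r u -> supported B s u.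
Proof.
move=> /subsetP AB rs; apply: (@supported_widen _ _ _ _ 0) => // x /AB Bx.
by exists x; rewrite ?distxx.
Qed.

Lemma supported_syn A r u a :
  supported A r u -> syn a u -> exists2 x, x \in A & dist x (cell a) <= r.+1.
Proof.
move=> Au /syn_local[q /Au[x Ax xq] aq]; exists x => //.
by have := dist_tri x (loc q) (cell a); rewrite (distC (loc q)); lia.
Qed.

(** * Cutting operators along separated clusters *)

Definition cut y r u : op := [ffun q => if dist y (loc q) <= r then u q else 0%R].

Lemma cut_supported y r u : supported [set y] r (cut y r u).
Proof.
by move=> q; rewrite ffunE; case: ifP => [? _|]; [exists y; rewrite ?inE|rewrite eqxx].
Qed.

(* When 2 * xi <= s, a set is gapped iff it splits into clusters of diameter at
   most xi at mutual distance greater than s. *)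
Definition gapped xi s A : Prop :=
  forall x y, x \in A -> y \in A -> dist x y <= s -> dist x y <= xi.

Lemma gapped_sub xi s A B : A \subset B -> gapped xi s B -> gapped xi s A.
Proof. by move=> /subsetP AB gB x y /AB Bx /AB By; apply: gB. Qed.

(** The cluster of [y] is far from [W] and from the rest of [Y], so [u] vanishes at distances
    between [M + r] and [M + r + 2] from [y]. A defect sees only qubits at distance at most 1, so
    cutting there creates no new defect. *)
Lemma syn_cut W Y M r s t u y a :
  supported (W :|: Y) r u -> gapped M s Y ->
  M + 2 * r + 2 <= s -> M + 2 * r + 2 <= t ->
  y \in Y -> (forall x, x \in W -> t < dist x y) ->
  syn a (cut y (M + r) u) = syn a u && (dist y (cell a) <= M + r + 1).
Proof.
move=> Wu gY rs rt Yy far; case: leqP => ya; last first.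
  rewrite andbF; apply/negP => /(supported_syn (@cut_supported _ _ _))[x].
  by rewrite inE => /eqP->; lia.
rewrite andbT; rewrite -[u in RHS](subrK (cut y (M + r) u)) synD.
suff /negPf-> : ~~ syn a (u - cut y (M + r) u)%R by [].
apply/negP => /syn_local[q uq aq].
have [uq0 yq] : u q != 0%R /\ M + r < dist y (loc q).
  move: uq; rewrite !ffunE; case: leqP; rewrite ?subrr ?eqxx // subr0.
  by move=> ? ?; split.
have [x Wx xq] := Wu _ uq0.
have := dist_tri y (cell a) (loc q); have := dist_tri y (loc q) x.
rewrite (distC (loc q)) => H1 H2.
move: Wx; rewrite inE => /orP[/far|Yx]; first by rewrite distC; lia.
have := gY _ _ Yy Yx; have := dist_tri y x (loc q); lia.
Qed.

(** The clusters of [Y] far from [W] are cut off one by one and replaced by their local equivalents;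
    what is left lies near [W], where [WB] applies. *)
Lemma glue W Y B M r s t r' u :
  supported (W :|: Y) r u -> gapped M s Y -> 2 * M + 2 * r <= s ->
  (forall w, supported W (t + r) w -> supported B r' w) ->
  (forall y, y \in Y -> (forall x, x \in W -> t < dist x y) ->
     exists2 w, equiv (cut y (M + r) u) w & supported B r' w) ->
  exists2 w, equiv u w & supported B r' w.
Proof.
move=> + + hs WB; have [n leYn] := ubnP #|Y|.
elim: n Y u leYn => // n IH Y u leYn Wu gY loc_u.
have [[y [Yy far]]|near] :=
    EM (exists y, y \in Y /\ forall x, x \in W -> t < dist x y); last first.
  exists u; first exact: equivxx.
  apply: WB => q /Wu[x + xq]; rewrite inE => /orP[Wx|Yx].
    by exists x => //; lia.
  have [z Wz zx] : exists2 z, z \in W & dist z x <= t.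
    apply: contrapT => noz; apply: near; exists x; split => // z Wz.
    by rewrite ltnNge; apply/negP => zx; apply: noz; exists z.
  by exists z => //; have := dist_tri z x (loc q); lia.
have [w1 uw1 Bw1] := loc_u y Yy far.
pose Y' := [set z in Y | ~~ (dist y z <= M)].
have Y'Y : Y' \subset Y by apply/subsetP => z; rewrite inE => /andP[].
pose u' := (u - cut y (M + r) u)%R.
have [||||w2 u'w2 Bw2] := IH Y' u'.
- apply: (@leq_trans #|Y|); last by rewrite -ltnS.
  apply: proper_card; apply/properP; split=> //.
  by exists y; rewrite // inE distxx leq0n andbF.
- move=> q; rewrite !ffunE; case: leqP; rewrite ?subrr ?eqxx // subr0.
  move=> yq /Wu[x Wx xq]; exists x => //; move: Wx; rewrite !inE.
  case: (x \in W) => //= ->; rewrite -ltnNge.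
  by have := dist_tri y x (loc q); lia.
- exact: gapped_sub gY.
(* Clusters are separated, so removing the piece around [y] leaves the piece around [z]
   unchanged. *)
- move=> z; rewrite inE -ltnNge => /andP[Yz yz] farz.
  have -> : cut z (M + r) u' = cut z (M + r) u; last exact: loc_u.
  apply/ffunP => q; rewrite !ffunE; case: leqP => // zq; case: leqP => [yq|].
    have := gY _ _ Yy Yz; have := dist_tri y (loc q) z.
    by rewrite (distC (loc q)); lia.
  by rewrite subr0.
exists (w1 + w2)%R; last exact: supportedD.
rewrite -[u](subrK (cut y (M + r) u)) addrC.
exact: equivD.
Qed.

(** * Neutral and charged clusters *)

Variables (neutral : {set T} -> Prop) (tau lam : nat).
Hypothesis neutral_local : forall y u,
  supported [set y] tau u -> neutral (syndrome u).
Hypothesis stab_local : forall y u,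
  supported [set y] tau u -> syndrome u = set0 -> stab u.
Hypothesis neutral_creation : forall S a r, neutral S -> a \in S ->
  (forall b, b \in S -> dist (cell a) (cell b) <= r) ->
  exists2 u, syndrome u = S & supported [set cell a] (2 * r + 3) u.
Hypothesis lam_ge3 : 3 <= lam.
Hypothesis no_string : forall y u S1 S2 y1 y2 xi, 1 <= xi ->
  supported [set y] tau u -> syndrome u = S1 :|: S2 ->
  (forall b, b \in S1 -> dist y1 (cell b) <= xi) ->
  (forall b, b \in S2 -> dist y2 (cell b) <= xi) ->
  lam * xi <= dist y1 y2 -> neutral S1.

Definition cluster xi u a : {set T} :=
  [set b | syn b u && (dist (cell a) (cell b) <= xi)].

Definition charged xi u : Prop := forall a, syn a u -> ~ neutral (cluster xi u a).

Definition cleaned xi f f' : Prop :=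
  [/\ syndrome f' \subset syndrome f, charged xi f'
    & supported (positions f) (5 * xi) (f - f')%R].

(** One-sided form of [localized]: only the initial defects may be used. Unlike [localized], it
    composes with additive radii, see [reach_trans]. *)
Definition reach r f g : Prop :=
  exists2 w, equiv (g - f)%R w & supported (positions f) r w.

Definition localized r f g : Prop :=
  exists2 w, equiv (g - f)%R w & supported (positions f :|: positions g) r w.

Lemma positions_cleaned xi f f' : cleaned xi f f' -> positions f' \subset positions f.
Proof. by case=> ff' _ _; apply: imsetS. Qed.

Lemma supported1 x A r s u :
  x \in A -> r <= s -> supported [set x] r u -> supported A s u.
Proof. by move=> Ax; apply: supported_sub; rewrite sub1set. Qed.

(** Neutral clusters are removed one at a time, each by an operator within [2 * xi + 3 <= 5 * xi] of
    one of its own defects. The syndrome shrinks strictly, so this stops. *)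
Lemma cleaning xi f : 1 <= xi -> exists f', cleaned xi f f'.
Proof.
move=> xi1; have [n len] := ubnP #|syndrome f|.
elim: n f len => // n IH f len.
have [[a [af /neutral_creation nf]]|nof] :=
    EM (exists a, syn a f /\ neutral (cluster xi f a)); last first.
  exists f; split=> //; last by rewrite subrr; apply: supported0.
  by move=> a af nf; apply: nof; exists a.
have [||u Su u_sup] := nf a xi.
- by rewrite inE af distxx.
- by move=> b; rewrite inE => /andP[].
have synu b : syn b u = syn b f && (dist (cell a) (cell b) <= xi).
  by have := in_set (fun b => syn b u) b; rewrite -/(syndrome u) Su inE.
have sub : syndrome (f - u)%R \subset syndrome f.
  by apply/subsetP => b; rewrite !inE syn_sub synu; case: (syn b f).
have [|f' [f'f f'c f'_sup]] := IH (f - u)%R.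
  apply: (@leq_trans #|syndrome f|); last by rewrite -ltnS.
  apply: proper_card; apply/properP; split=> //.
  by exists a; rewrite !inE // syn_sub synu af distxx.
exists f'; split=> //; first exact: subset_trans sub.
have -> : (f - f' = (f - u - f') + u)%R by rewrite addrAC subrK.
apply: supportedD.
  by apply: supported_sub f'_sup => //; apply: imsetS.
apply: supported1 u_sup; last by lia.
exact: mem_positions.
Qed.

Lemma localizedC r f g : localized r f g -> localized r g f.
Proof.
case=> w fgw w_sup; exists (- w)%R.
  by rewrite -opprB; apply: equivN.
by rewrite setUC; apply: supportedN.
Qed.

Lemma reach_widen r s f g : r <= s -> reach r f g -> reach s f g.
Proof. by move=> rs [w fgw w_sup]; exists w => //; apply: supported_sub w_sup. Qed.

Lemma reach_positions r f g x : reach r f g -> x \in positions g ->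
  exists2 y, y \in positions f & dist y x <= r.+1.
Proof.
case=> w fgw w_sup /positionsP[a ag ->].
have := syn_equiv a fgw; rewrite syn_sub ag.
case: (boolP (syn a f)) => [af _|_ /esym]; last exact: supported_syn.
by exists (cell a); rewrite ?distxx ?mem_positions.
Qed.

Lemma reach_trans r s g f h : reach r f g -> reach s g h -> reach (r + s + 1) f h.
Proof.
move=> fg [w2 ghw2 w2_sup]; have [w1 fgw1 w1_sup] := fg.
exists (w1 + w2)%R.
  by rewrite -(subrKA g) addrC; apply: equivD.
apply: supportedD; first by apply: supported_sub w1_sup => //; lia.
by apply: supported_widen w2_sup; [move=> x; apply: reach_positions fg|lia].
Qed.

(** * Transport of charged clusters at a fixed scale *)

Section Scale.

(* The constants in sep leave room for twice the largest radius that occurs,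
   5 * hop + 72 * xi in [tighten]. *)
Variable xi : nat.
Hypothesis xi_gt0 : 1 <= xi.
Notation hop := (lam * xi).
Notation sep := (10 * hop + 200 * xi).
Hypothesis sep_tau : sep <= tau.

(* Away from W every defect of u is a defect of g; a cluster of Y far from W
   would create a single charged cluster of g locally, so it creates nothing. *)
Lemma expel W Y r u g :
  supported (W :|: Y) r u -> gapped xi sep Y -> gapped xi sep (positions g) ->
  charged xi g -> (forall a, cell a \notin W -> syn a u = syn a g) ->
  2 * xi + 2 * r + 2 <= sep ->
  exists2 w, equiv u w & supported W (2 * xi + 3 * r + 2) w.
Proof.
move=> u_sup gY gg cg ug rs.
(* A defect of the cut piece lies within [xi + r + 1] of [y], its whole cluster in [g] within
   [2 * xi + r + 1], and [u] creates defects within [r + 1] of its support; the sum is [t]. *)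
apply: (glue (t := 2 * xi + 2 * r + 2) u_sup gY); first by lia.
  by move=> w; apply: supported_sub => //; lia.
move=> y Yy far; set v := cut _ _ _.
have loc_v : supported [set y] tau v.
  by apply: supported1 (@cut_supported _ _ _); rewrite ?inE //; lia.
have notW b : dist y (cell b) <= 2 * xi + 2 * r + 2 -> cell b \notin W.
  by move=> yb; apply/negP => /far; rewrite distC; lia.
have synv b : syn b v = syn b g && (dist y (cell b) <= xi + r + 1).
  rewrite (syn_cut _ u_sup gY _ _ Yy far); try lia.
  case: leqP => // yb; rewrite ?andbF // ug //; apply: notW; lia.
exists 0%R; last exact: supported0.
rewrite /equiv subr0; apply: (stab_local loc_v); apply/setP => a; rewrite !inE.
apply/negP => av; have := av; rewrite synv => /andP[ag ya].
apply: (cg a ag).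
suff -> : cluster xi g a = syndrome v by apply: neutral_local loc_v.
apply/setP => b; rewrite !inE synv.
case: (boolP (syn b g)) => //= bg; apply/idP/idP => [ab|yb].
  have yb := dist_tri y (cell a) (cell b).
  have : syn b u by rewrite ug //; apply: notW; lia.
  move=> /(supported_syn u_sup)[z]; rewrite inE => /orP[/far|Yz] zb.
    by have := dist_tri z (cell b) y; rewrite (distC (cell b)); lia.
  have := gY _ _ Yy Yz; have := dist_tri y (cell b) z.
  by have := dist_tri y z (cell b); rewrite (distC (cell b) z); lia.
have := gg _ _ (mem_positions ag) (mem_positions bg).
by have := dist_tri (cell a) y (cell b); rewrite (distC (cell a) y); lia.
Qed.

(** [g'] is charged, so [expel] discards the clusters of [g] far from [f]; sparsity of [f] is not
    assumed. The radius is [2 * xi + 3 * (5 * xi) + 2 <= 19 * xi]. *)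
Lemma entry f g g' :
  localized xi f g -> gapped xi sep (positions g) -> cleaned xi g g' ->
  reach (19 * xi) f g'.
Proof.
move=> [w fgw w_sup] gg gg'; have [_ cg' g'_sup] := gg'.
have ggp := gapped_sub (positions_cleaned gg') gg.
have fg'w : equiv (g' - f)%R (w - (g - g'))%R.
  have -> : (g' - f = (g - f) - (g - g'))%R by rewrite opprB [RHS]addrC subrKA.
  by apply: equivB => //; apply: equivxx.
have [|||w' ww' w'_sup] := @expel (positions f) (positions g) (5 * xi) (w - (g - g'))%R g' _ gg ggp cg'.
- apply: supportedB; last by apply: supported_sub g'_sup => //; apply: subsetUr.
  by apply: supported_sub w_sup => //; lia.
- move=> a af; rewrite -(syn_equiv a fg'w) syn_sub.
  by case: (boolP (syn a f)) => [/mem_positions|]; rewrite ?(negPf af) ?addbF.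
- by lia.
exists w'; first exact: equiv_trans fg'w ww'.
by apply: supported_sub w'_sup => //; lia.
Qed.

(** Here [expel] discards the clusters of [f] lost in the cleaning: far from [f'] they could only
    produce charged clusters locally. The radius is [2 * xi + 3 * (19 * xi) + 2 <= 61 * xi]. *)
Lemma cleaned_step f f' g' :
  gapped xi sep (positions f) -> cleaned xi f f' ->
  gapped xi sep (positions g') -> charged xi g' ->
  reach (19 * xi) f g' -> reach (61 * xi) f' g'.
Proof.
move=> gf [_ _ f'_sup] gg' cg' [w fg'w w_sup].
have f'g'w : equiv (g' - f')%R (w + (f - f'))%R.
  by rewrite -(subrKA f); apply: equivD => //; apply: equivxx.
have [|||w' ww' w'_sup] := @expel (positions f') (positions f) (19 * xi) (w + (f - f'))%R g' _ gf gg' cg'.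
- apply: (@supported_sub (positions f) _ (19 * xi)); [exact: subsetUr|by []|].
  by apply: supportedD => //; apply: supported_sub f'_sup => //; lia.
- move=> a af; rewrite -(syn_equiv a f'g'w) syn_sub.
  by case: (boolP (syn a f')) => [/mem_positions|]; rewrite ?(negPf af) ?addbF.
- by lia.
exists w'; first exact: equiv_trans f'g'w ww'.
by apply: supported_sub w'_sup => //; lia.
Qed.

(* By the no-strings rule each charged cluster of f stays within hop of exactly
   one charged cluster of g, so the piece of g - f around it creates a small
   neutral set of defects and can be replaced by an operator near that set. *)
Lemma tighten f g :
  gapped xi sep (positions f) -> charged xi f ->
  gapped xi sep (positions g) -> charged xi g ->
  reach (5 * hop + 70 * xi) f g -> reach (5 * hop + 8 * xi) f g.
Proof.
move=> gf cf gg cg [u fgu u_sup].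
have hop3 : 3 * xi <= hop by rewrite leq_mul2r lam_ge3 orbT.
have synu b : syn b u = syn b g (+) syn b f by rewrite -(syn_equiv b fgu) syn_sub.
suff [w uw w_sup] : exists2 w, equiv u w & supported (positions f) (5 * hop + 8 * xi) w.
  by exists w => //; apply: equiv_trans uw.
have u_sup0 : supported (set0 :|: positions f) (5 * hop + 70 * xi) u by rewrite set0U.
pose t := 10 * hop + 150 * xi.
(* With [W] empty every cluster of [f] counts as far, so all of [u] gets replaced. *)
apply: (glue (t := t) u_sup0 gf); first by lia.
  by move=> w w0 q /w0[x]; rewrite inE.
move=> y Yy far; set v := cut _ _ _.
have loc_v : supported [set y] tau v.
  by apply: supported1 (@cut_supported _ _ _); rewrite ?inE //; lia.
have [a af ya] := positionsP _ _ Yy.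
pose win := xi + (5 * hop + 70 * xi) + 1.
have synv b : syn b v = (syn b g (+) syn b f) && (dist y (cell b) <= win).
  by rewrite (syn_cut _ u_sup0 gf _ _ Yy far) ?synu //; rewrite /t; lia.
have near_f b : syn b f -> (dist (cell a) (cell b) <= xi) = (dist y (cell b) <= win).
  move=> bf; rewrite -ya; apply/idP/idP => [|yb]; first by rewrite /win; lia.
  by apply: gf => //; [exact: mem_positions|move: yb; rewrite /win; lia].
(* Without a defect of [g] in the window, [v] would create exactly the cluster of [a], making it
   neutral. *)
have [[b [bg yb]]|nog] := EM (exists b, syn b g /\ dist y (cell b) <= win); last first.
  case: (cf a af).
  suff -> : cluster xi f a = syndrome v by apply: neutral_local loc_v.
  apply/setP => b; rewrite !inE synv.
  have [bf|bf] /= := boolP (syn b f).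
    rewrite near_f //; case: leqP => //= yb; rewrite ?andbF // andbT.
    by case: (boolP (syn b g)) => // bg; case: nog; exists b.
  rewrite addbF; apply/esym/negP => /andP[bg yb].
  by apply: nog; exists b.
have near_g c : syn c g -> (dist (cell b) (cell c) <= xi) = (dist y (cell c) <= win).
  move=> cg'; have Hyc := dist_tri y (cell b) (cell c).
  apply/idP/idP => [bc|yc]; last first.
    apply: gg; rewrite ?mem_positions //.
    by have := dist_tri (cell b) y (cell c); rewrite (distC _ y); move: yc yb; rewrite /win; lia.
  have [cf'|cf'] := boolP (syn c f).
    have := gf y (cell c) Yy (mem_positions cf').
    by move: yb; rewrite /win; lia.
  have : syn c u by rewrite synu cg' (negPf cf').
  move=> /(supported_syn u_sup)[z fz zc].
  have := gf _ _ Yy fz; have := dist_tri y (cell c) z.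
  have := dist_tri y z (cell c); rewrite (distC (cell c) z).
  by move: yb; rewrite /win; lia.
have synvE c : syn c v = (c \in cluster xi g b) (+) (c \in cluster xi f a).
  rewrite !inE synv.
  have [cg'|/negPf cg'] := boolP (syn c g); have [cf'|/negPf cf'] := boolP (syn c f);
    rewrite ?cg' ?cf' /= ?near_g ?near_f ?addbF //.
  by rewrite addbb.
(* Otherwise the two clusters are disjoint, as [hop >= 3 * xi], and [v] is a string segment between
   them, making the cluster of [a] neutral. *)
have ab : dist y (cell b) < hop.
  rewrite ltnNge; apply/negP => hab; case: (cf a af).
  apply: (no_string (y1 := cell a) (y2 := cell b) (S2 := cluster xi g b) xi_gt0 loc_v).
  - apply/setP => c; rewrite inE synvE in_setU addbC.
    case: (boolP (c \in cluster xi f a)) => //= + /=.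
    rewrite inE => /andP[_ ac]; apply/negP; rewrite inE => /andP[_ bc].
    have := dist_tri (cell a) (cell c) (cell b); rewrite (distC (cell c)).
    by move: hab; rewrite ya; lia.
  - by move=> c; rewrite inE => /andP[].
  - by move=> c; rewrite inE => /andP[].
  - by rewrite -ya.
have near_v c : c \in syndrome v -> dist y (cell c) <= hop + xi.
  rewrite inE synvE; case: (boolP (c \in cluster xi f a)); rewrite inE ya.
    by move=> /andP[_ ac] _; lia.
  rewrite addbF inE => _ /andP[_ bc].
  by have := dist_tri y (cell b) (cell c); rewrite -ya; lia.
have [v0|[c cv]] := set_0Vmem (syndrome v).
  exists 0%R; last exact: supported0.
  by rewrite /equiv subr0; apply: stab_local loc_v v0.
have yc := near_v c cv.
(* [n] has radius [2 * (2 * hop + 2 * xi) + 3] about [cell c], which is within [hop + xi] of [y];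
   the total is at most [5 * hop + 8 * xi]. *)
have [d dv|n Sn n_sup] := neutral_creation (r := 2 * hop + 2 * xi) (neutral_local loc_v) cv.
  have := near_v d dv; have := dist_tri (cell c) y (cell d).
  by rewrite (distC _ y); lia.
have n_sup' : supported [set y] (5 * hop + 8 * xi) n.
  apply: (supported_widen (t := hop + xi) _ _ n_sup); last by lia.
  by move=> x; rewrite inE => /eqP->; exists y; rewrite ?inE.
exists n; last by apply: supported1 n_sup'.
apply: (@stab_local y).
  apply: supportedB => //.
  by apply: supported1 n_sup'; rewrite ?inE //; lia.
apply/setP => d; rewrite !inE syn_sub.
have : (d \in syndrome n) = (d \in syndrome v) by rewrite Sn.
by rewrite !inE => ->; rewrite addbb.
Qed.

End Scale.

(** * Contraction of stretches of the path *)

(** [ok] constrains intermediate points only: the ends of a contracted stretch are typically states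
    that fail to be sparse. *)
Inductive chain (R : op -> op -> Prop) (ok : op -> Prop) : op -> op -> Prop :=
| chain1 f g : R f g -> chain R ok f g
| chainS f g h : R f g -> ok g -> chain R ok g h -> chain R ok f h.

Lemma chain_sub (R R' : op -> op -> Prop) (ok ok' : op -> Prop) f g :
  (forall f g, R f g -> R' f g) -> (forall f, ok f -> ok' f) ->
  chain R ok f g -> chain R' ok' f g.
Proof.
move=> RR' okk; elim=> {f g} [f g /RR'|f g h /RR' fg /okk okg _ gh].
  exact: chain1.
exact: chainS fg okg gh.
Qed.

(** Breaking the chain exactly at the intermediate points outside [P] yields stretches whose
    interior lies in [P]. *)
Lemma chain_group (R : op -> op -> Prop) (ok P : op -> Prop) f g :
  chain R ok f g -> chain (chain R P) (fun h => ok h /\ ~ P h) f g.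
Proof.
elim=> {f g} [f g fg|f g h fg okg _ IH]; first by do 2!apply: chain1.
have [Pg|nPg] := EM (P g); last by apply: chainS IH => //; apply: chain1.
case: IH Pg okg fg => {g h} [g h gh|g k h gk okk kh] Pg okg fg.
  by apply: chain1; apply: chainS gh.
by apply: chainS kh => //; apply: chainS gk.
Qed.

Section Renormalization.

Variable xi : nat.
Hypothesis xi_gt0 : 1 <= xi.
Notation hop := (lam * xi).
Notation sep := (10 * hop + 200 * xi).
Hypothesis sep_tau : sep <= tau.
Notation sparse := (fun f => gapped xi sep (positions f)).

(** Induction along the chain with [f1] fixed: [tighten] restores the radius after every step, so
    drift does not accumulate, whatever the length. *)
Lemma chain_middle f f' f1 h :
  chain (localized xi) sparse f h -> sparse f -> cleaned xi f f' ->
  sparse f1 -> charged xi f1 -> reach (5 * hop + 8 * xi) f1 f' ->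
  exists u v, [/\ equiv (h - f1)%R (u + v)%R,
    supported (positions f1) (5 * hop + 8 * xi) u
    & supported (positions h) (19 * xi) v].
Proof.
move=> fh; elim: fh f' => {f h} [f h fh|f g h fg gg gh IH] f' gf ff' gf1 cf1 f1f'.
  (* The last step is read backwards, since [h] need not be sparse while [f] is. *)
  have [v hf'v v_sup] := entry xi_gt0 sep_tau (localizedC fh) gf ff'.
  have [u f1f'u u_sup] := f1f'.
  exists u, (- v)%R; split=> //; last exact: supportedN.
  have -> : (h - f1 = (f' - f1) - (f' - h))%R by rewrite opprB [RHS]addrC subrKA.
  exact: equivB.
have [g' gg'] := cleaning g xi_gt0.
have fg' := entry xi_gt0 sep_tau fg gg gg'.
have [_ cg' _] := gg'.
have ggp := gapped_sub (positions_cleaned gg') gg.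
have f'g' := cleaned_step xi_gt0 sep_tau gf ff' ggp cg' fg'.
apply: (IH g') => //; apply: tighten => //.
(* [5 * hop + 8 * xi] and [61 * xi], plus 1, stay within the radius that [tighten] accepts. *)
by apply: reach_widen (reach_trans f1f' f'g'); lia.
Qed.

(** Neither end need be sparse, so [chain_middle] starts at the cleaned first intermediate state,
    which [entry] links to [f]. *)
Lemma localized_coarsen f h : chain (localized xi) sparse f h ->
  localized (5 * hop + 30 * xi) f h.
Proof.
case=> {f h} [f h [w fhw w_sup]|f g h fg gg gh].
  by exists w => //; apply: supported_sub w_sup => //; lia.
have [g' gg'] := cleaning g xi_gt0.
have fg' := entry xi_gt0 sep_tau fg gg gg'; have [w fg'w w_sup] := fg'.
have [_ cg' _] := gg'.
have ggp := gapped_sub (positions_cleaned gg') gg.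
have [|u [v [g'huv u_sup v_sup]]] := chain_middle gh gg gg' ggp cg'.
  by exists 0%R; [rewrite subrr; apply: equivxx|apply: supported0].
exists (w + (u + v))%R.
  by rewrite -(subrKA g') addrC; apply: equivD.
apply: supportedD; first by apply: supported_sub w_sup; [apply: subsetUl|lia].
apply: supportedD; last by apply: supported_sub v_sup; [apply: subsetUr|lia].
apply: (@supported_sub (positions f) _ (5 * hop + 30 * xi)); [exact: subsetUl|by []|].
by apply: supported_widen u_sup; [move=> x; apply: reach_positions fg'|lia].
Qed.

End Renormalization.

Lemma positions_eq0 f : syndrome f = set0 -> positions f = set0.
Proof. by rewrite /positions => ->; rewrite imset0. Qed.

(** If the step has no defects it is a stabilizer by local topological order; otherwise one of its
    defects, adjacent to [q0], is a defect of [f] or of [g]. *)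
Lemma localized_single f g q0 :
  (forall q, (g - f)%R q != 0%R -> q = q0) -> localized 1 f g.
Proof.
move=> sgl.
have [e0|[a]] := set_0Vmem (syndrome (g - f)%R).
  exists 0%R; last exact: supported0.
  rewrite /equiv subr0; apply: (@stab_local (loc q0)) e0 => q /sgl->.
  by exists (loc q0); rewrite ?inE ?distxx.
rewrite inE => ae; exists (g - f)%R; first exact: equivxx.
have [q /sgl-> aq] := syn_local ae.
move=> ? /sgl->; exists (cell a) => //; rewrite inE.
move: ae; rewrite syn_sub.
by case: (boolP (syn a f)) => [/mem_positions->|_]; rewrite ?addbF // => /mem_positions->; rewrite orbT.
Qed.

Lemma chain_vacuum r ok f g : chain (localized r) ok f g ->
  (forall h, ok h -> syndrome h = set0) -> syndrome f = set0 -> syndrome g = set0 ->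
  equiv g f.
Proof.
move=> fg ok0.
have vac f' g' : localized r f' g' -> syndrome f' = set0 -> syndrome g' = set0 ->
    equiv g' f'.
  case=> w fgw w_sup /positions_eq0 f0 /positions_eq0 g0.
  suff w0 : w = 0%R by rewrite w0 /equiv subr0 in fgw.
  apply/ffunP => q; rewrite ffunE; apply: contrapT => /eqP /w_sup[x].
  by rewrite f0 g0 setU0 inE.
elim: fg => {f g} [f g fg|f g h fg /ok0 g0 _ IH] f0 h0; first exact: vac.
exact: equiv_trans (IH g0 h0) (vac _ _ fg f0 g0).
Qed.

(** * Iteration over the scales *)

(** Four times [sep / xi]: this dominates both the growth [5 * lam + 30] of the step radius and the
    doubled covering radius [3 + 2 * sep / xi] after a merger. *)
Notation ratio := (4 * (10 * lam + 200)).
Notation sparse_at p := (gapped (ratio ^ p) (10 * (lam * ratio ^ p) + 200 * ratio ^ p)).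

(* At every scale where A is not sparse, two centres of the cover are merged; the
   ratio keeps the covering radius below half of the next scale. *)
Lemma cover_dense p A : (forall q, q < p -> ~ sparse_at q A) ->
  exists Y, [/\ Y \subset A, #|Y| + p <= #|A|
    & forall x, x \in A -> exists2 y, y \in Y & 2 * dist y x <= ratio ^ p].
Proof.
elim: p => [|p IH] dense.
  by exists A; split=> // [|x Ax]; [rewrite addn0|exists x; rewrite ?distxx].
have [q qp|Y [YA cardY covY]] := IH; first by apply: dense; lia.
have [x [y [Ax Ay dxy xy]]] : exists x y, [/\ x \in A, y \in A,
    dist x y <= 10 * (lam * ratio ^ p) + 200 * ratio ^ p & ratio ^ p < dist x y].
  apply: contrapT => none; apply: (dense p (ltnSn p)) => x y Ax Ay dxy.
  by rewrite leqNgt; apply/negP => xy; apply: none; exists x, y.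
have [u Yu ux] := covY x Ax; have [v Yv vy] := covY y Ay.
have uv : u != v.
  apply/eqP => uv; rewrite -{}uv in vy.
  by have := dist_tri x u y; rewrite (distC x u); lia.
exists (Y :\ v); split.
- by apply: subset_trans YA; apply: subD1set.
- by move: cardY; rewrite (cardsD1 v Y) Yv; lia.
- move=> z /covY[w Yw wz].
  have r0 : 0 < ratio ^ p by rewrite expn_gt0; lia.
  have [wv|wv] := eqVneq w v; last first.
    by exists w; rewrite ?in_setD1 ?wv // expnS; nia.
  exists u; first by rewrite in_setD1 uv.
  rewrite {}wv in wz; rewrite expnS.
  have := dist_tri u x z; have := dist_tri x y z; have := dist_tri y v z.
  by rewrite (distC y v); lia.
Qed.

(** At each scale the sparse intermediate states are absorbed into longer steps; a surviving state
    is sparse at none of the scales treated so far. *)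
Lemma chain_level m p f g :
  (forall q, q < p -> 10 * (lam * ratio ^ q) + 200 * ratio ^ q <= tau) ->
  chain (localized 1) (fun h => #|syndrome h| <= m) f g ->
  chain (localized (ratio ^ p)) (fun h => #|syndrome h| <= m /\
    forall q, q < p -> ~ sparse_at q (positions h)) f g.
Proof.
elim: p => [|p IH] small fg; first by apply: chain_sub fg.
have /chain_group {}fg := IH (fun q qp => small q (ltnW qp)) fg.
have r0 : 1 <= ratio ^ p by rewrite expn_gt0; lia.
apply: chain_sub (fg (fun h => sparse_at p (positions h))) => [f' g'|h].
  move=> /(localized_coarsen r0 (small p (ltnSn p)))[w fgw w_sup].
  by exists w => //; apply: supported_sub w_sup; rewrite ?expnS //; nia.
case=> -[hm dense] np; split=> // q; rewrite ltnS leq_eqVlt.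
by move=> /predU1P[->//|]; apply: dense.
Qed.

(** After [m] scales the cover given by [cover_dense] has at most [m - m = 0] centres, so a
    surviving intermediate state has no defects. *)
Lemma low_energy_stab m f g :
  (forall q, q < m -> 10 * (lam * ratio ^ q) + 200 * ratio ^ q <= tau) ->
  chain (localized 1) (fun h => #|syndrome h| <= m) f g ->
  syndrome f = set0 -> syndrome g = set0 -> equiv g f.
Proof.
move=> small /(chain_level small) fg; apply: chain_vacuum fg _ => h [hm dense].
have [Y [_ cardY covY]] := cover_dense dense.
have Y0 : Y = set0.
  apply/eqP; rewrite -cards_eq0.
  by have : #|positions h| <= #|syndrome h| by [apply: leq_imset_card]; lia.
apply/setP => a; rewrite !inE; apply/negP => /mem_positions /covY[y].
by rewrite Y0 inE.
Qed.

End Core.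

(** * Geometry of the torus *)

Section Torus.

Variables D L : nat.
Implicit Types (x y z a : site D L).

Lemma coord_distC (i j : 'I_L) : coord_dist i j = coord_dist j i.
Proof. by rewrite /coord_dist addnC. Qed.

Lemma coord_dist_tri (i j k : 'I_L) : coord_dist i k <= coord_dist i j + coord_dist j k.
Proof.
rewrite /coord_dist /=; have := ltn_ord i; have := ltn_ord j; have := ltn_ord k; lia.
Qed.

Lemma distxx x : dist x x = 0.
Proof.
by apply/eqP; rewrite -leqn0; apply/bigmax_leqP => i _; rewrite /coord_dist /=; lia.
Qed.

Lemma distC x y : dist x y = dist y x.
Proof. by apply: eq_bigr => i _; apply: coord_distC. Qed.

Lemma coord_dist_le x y i : coord_dist (x i) (y i) <= dist x y.
Proof. exact: (leq_bigmax i). Qed.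

Lemma dist_tri x y z : dist x z <= dist x y + dist y z.
Proof.
apply/bigmax_leqP => i _; apply: leq_trans (coord_dist_tri _ (y i) _) _.
by apply: leq_add; apply: coord_dist_le.
Qed.

Lemma coord_dist_shift (i j : 'I_L) k : j = i + k %[mod L] -> coord_dist i j <= k.
Proof.
have := ltn_ord i; have := ltn_ord j; rewrite /coord_dist /= => jL iL.
rewrite modn_small // => jE.
have [kL|kL] := ltnP k L; last by lia.
have [ikL|ikL] := ltnP (i + k) L; first by rewrite modn_small // in jE; lia.
have : (i + k) %% L = i + k - L.
  by rewrite -{1}(subnK ikL) modnDr modn_small //; lia.
lia.
Qed.

Lemma cubeP a l x :
  reflect (forall i, exists2 k, k < l & x i = a i + k %[mod L]) (x \in cube a l).
Proof.
rewrite inE; apply: (iffP forallP) => h i.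
  by have /existsP[k /eqP xk] := h i; exists k.
by have [k kl xk] := h i; apply/existsP; exists (Ordinal kl); apply/eqP.
Qed.

Lemma dist_cube a l x y : x \in cube a l -> y \in cube a l -> dist x y <= l.-1.
Proof.
move=> /cubeP xa /cubeP ya; apply/bigmax_leqP => i _.
have [k kl xk] := xa i; have [k' kl' yk] := ya i.
wlog kk : x y xa ya k k' kl kl' xk yk / k <= k'.
  move=> W; have [kk|/ltnW kk] := leqP k k'; first exact: (W x y _ _ k k').
  by rewrite coord_distC; apply: (W y x _ _ k' k).
apply: (@leq_trans (k' - k)); last by lia.
apply: coord_dist_shift.
by rewrite yk -(subnKC kk) addnA -modnDml -xk modnDml addnC subnKC // addnC.
Qed.

Lemma ball_cube y r : exists a, forall x, dist y x <= r -> x \in cube a (2 * r + 1).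
Proof.
have L0 (i : 'I_D) : 0 < L by have := ltn_ord (y i); lia.
(* The corner is [y - r] modulo [L], with [- r] written as [r * L.-1] to avoid truncated
   subtraction. *)
exists [ffun i => Ordinal (ltn_pmod (y i + r * L.-1) (L0 i))] => x yx.
apply/cubeP => i; rewrite ffunE /=.
have := leq_trans (coord_dist_le y x i) yx; rewrite /coord_dist /=.
have xL := ltn_ord (x i); have yL := ltn_ord (y i); have L1 := L0 i.
have key k c : y i + r * L.-1 + k = x i + c * L ->
    x i = (y i + r * L.-1) %% L + k %[mod L].
  by rewrite modnDml => ->; rewrite addnC modnMDl.
have rL : r * L.-1 + r = r * L by rewrite -mulnSr prednK.
(* The short way from [y i] to [x i] does not wrap, wraps downwards, or wraps upwards; [c] counts
   the multiples of [L]. *)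
have [d1|d1] := leqP ((y i - x i) + (x i - y i)) r => d2.
  exists (x i + r - y i); first by lia.
  by apply: (key _ r); rewrite -rL; lia.
have [xy|xy] := leqP (y i) (x i).
  exists (x i + r - y i - L); first by lia.
  have [c rc] : exists c, r = c.+1 by exists r.-1; lia.
  by apply: (key _ c); move: rL; rewrite [in RHS]rc [in RHS]mulSn; lia.
exists (x i + r + L - y i); first by lia.
by apply: (key _ r.+1); rewrite mulSn -rL; lia.
Qed.

Lemma elementary_cube_id a : a \in elementary_cube a.
Proof. by apply/cubeP => i; exists 0 => //; rewrite addn0. Qed.

Lemma elementary_cube_dist a x : x \in elementary_cube a -> dist a x <= 1.
Proof. by move=> ax; apply: (dist_cube (elementary_cube_id a)). Qed.

End Torus.

(** * Pauli operators modulo phase *)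

Section Letters.

Lemma letter_mulC : commutative letter_mul.
Proof. by case; case. Qed.

Lemma letter_mul1 : left_id PI letter_mul.
Proof. by case. Qed.

Lemma letter_mulV : left_inverse PI id letter_mul.
Proof. by case. Qed.

(** Modulo phase the letters form the Klein four-group, so every letter is its own opposite. *)
HB.instance Definition _ :=
  GRing.isZmodule.Build letter letter_mulA letter_mulC letter_mul1 letter_mulV.

Variable Q : finType.
Implicit Types (P R : pauli Q) (s t : letter) (u v : {ffun Q -> letter}).

Lemma lettersM P R : letters (P * R)%g = (letters P + letters R)%R.
Proof. by apply/ffunP => q; rewrite !ffunE. Qed.

Lemma lettersV P : letters (P^-1)%g = (- letters P)%R.
Proof. by apply/ffunP => q; rewrite ffunE. Qed.

Lemma letters1 : letters (1%g : pauli Q) = 0%R.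
Proof. by apply/ffunP => q; rewrite !ffunE. Qed.

Lemma phase_scalarM k P : phase (pauli_scalar Q k * P)%g = (k + phase P)%R.
Proof. by rewrite /= big1 ?addr0 // => q _; rewrite ffunE; case: (letters P q). Qed.

Lemma letters_scalarM k P : letters (pauli_scalar Q k * P)%g = letters P.
Proof. by apply/ffunP => q; rewrite !ffunE; case: (letters P q). Qed.

Definition letter_anti s t : bool := letter_phase s t != letter_phase t s.

Lemma letter_antiB s t t' :
  letter_anti s (t - t')%R = letter_anti s t (+) letter_anti s t'.
Proof. by case: s; case: t; case: t'. Qed.

(** The symplectic form over the two-element field. *)
Definition anti u v : bool := \big[addb/false]_q letter_anti (u q) (v q).

Lemma antiB u v v' : anti u (v - v')%R = anti u v (+) anti u v'.
Proof.
by rewrite /anti -big_split; apply: eq_bigr => q _; rewrite !ffunE letter_antiB.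
Qed.

Lemma anti_neq0 u v : anti u v -> exists q, u q != PI /\ v q != PI.
Proof.
move=> uv; apply: contrapT => none; move: uv; rewrite /anti big1 // => q _.
have [uq|uq] := eqVneq (u q) PI; first by rewrite uq; case: (v q).
have [vq|vq] := eqVneq (v q) PI; first by rewrite vq; case: (u q).
by case: none; exists q.
Qed.

(** Exchanging the factors shifts the phase by 2 modulo 4 at each qubit where the letters
    anticommute, so only the parity counts. *)
Lemma anticommuteE P R : anticommute P R = anti (letters P) (letters R).
Proof.
have phase_sum : (\sum_q letter_phase (letters P q) (letters R q)
    = (if anti (letters P) (letters R) then 2 else 0)
      + \sum_q letter_phase (letters R q) (letters P q) :> 'Z_4)%R.
  rewrite /anti; elim/big_rec3: _ => [|q b x y _ ->]; first by rewrite addr0.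
  rewrite !addrA; congr (_ + _)%R; apply/eqP.
  by case: y; case: (letters P q); case: (letters R q).
have -> : anticommute P R = (phase (P * R)%g == 2 + phase (R * P)%g)%R.
  apply/eqP/eqP => [->|phE]; first by rewrite phase_scalarM.
  apply: (can_inj (@pauli_codeK Q)); congr pair; first by rewrite phase_scalarM.
  by rewrite letters_scalarM !lettersM addrC.
rewrite /= phase_sum [(phase P + phase R)%R]addrC [in LHS]addrCA (inj_eq (addIr _)).
by case: anti.
Qed.

End Letters.

(** * Stabilizer codes *)

Section Code.

Variables (D L : nat) (H : stabilizer_hamiltonian D L) (Ltqo : nat).
Hypothesis Ltqo_gt0 : 0 < Ltqo.
Local Notation op := {ffun qubit H -> letter}.
Implicit Types (u v : op) (E P : pauli (qubit H)) (S : {set 'I_(nterm H)}).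

Definition syn (a : 'I_(nterm H)) u : bool := anti (letters (term a)) u.

Definition stab u : Prop := exists2 P, P \in stabilizer_group H & letters P = u.

Local Notation supported := (supported (@dist D L) (@qubit_site D L H)).
Local Notation syndrome := (syndrome syn).
(** Largest radius for which [2 * tau + 1 <= Ltqo], so that a ball fits into a cube of size
    [Ltqo]. *)
Local Notation tau := (Ltqo.-1)./2.

Lemma tau_le : 2 * tau + 1 <= Ltqo.
Proof. by have := odd_double_half Ltqo.-1; lia. Qed.

Lemma defectsE E : defects E = syndrome (letters E).
Proof. by apply/setP => a; rewrite !inE anticommuteE. Qed.

Lemma syn_sub a u v : syn a (u - v)%R = syn a u (+) syn a v.
Proof. exact: antiB. Qed.

Lemma syn_local a u : syn a u ->
  exists2 q, u q != 0%R & dist (term_cell a) (qubit_site q) <= 1.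
Proof.
move=> /anti_neq0[q [/eqP aq uq]]; exists q => //.
by apply: elementary_cube_dist; apply: term_local aq.
Qed.

Lemma stab0 : stab 0%R.
Proof. by exists 1%g; rewrite ?group1 ?letters1. Qed.

Lemma stab_sub u v : stab u -> stab v -> stab (u - v)%R.
Proof.
move=> [P GP <-] [P' GP' <-]; exists (P * P'^-1)%g.
  by rewrite groupM ?groupV.
by rewrite lettersM lettersV.
Qed.

Lemma stabP E : stabilizer_up_to_phase E <-> stab (letters E).
Proof.
split=> [[k GE]|[P GP PE]].
  by exists (pauli_scalar _ k * E)%g; rewrite ?letters_scalarM.
exists (phase P - phase E)%R.
suff -> : (pauli_scalar _ (phase P - phase E)%R * E)%g = P by [].
apply: (can_inj (@pauli_codeK _)); rewrite /pauli_code.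
by rewrite phase_scalarM letters_scalarM PE subrK.
Qed.

Lemma commute_anti E P : commute E P -> anti (letters E) (letters P) = false.
Proof.
rewrite -anticommuteE => EP; apply/negP => /eqP /(congr1 (@phase _)).
rewrite phase_scalarM -EP => /eqP.
by rewrite -[X in X == _]add0r (inj_eq (addIr _)).
Qed.

Lemma syn_stab a u : stab u -> syn a u = false.
Proof.
case=> P GP <-; apply: commute_anti.
have /subsetP/(_ P GP) : stabilizer_group H \subset 'C[term a]%g.
  rewrite gen_subG; apply/subsetP => _ /imsetP[b _ ->].
  by apply/cent1P; apply: term_commute.
by move=> /cent1P.
Qed.

Lemma supportE E A r : supported A r (letters E) <->
  forall x, x \in Defs.support E -> exists2 y, y \in A & dist y x <= r.
Proof.
split=> [AE x /imsetP[q + ->]|AE q Eq]; first by rewrite inE => /AE.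
by apply: AE; apply: imset_f; rewrite inE.
Qed.

Lemma cube_mono a l l' : l <= l' -> cube a l \subset (cube a l' : {set site D L}).
Proof.
move=> ll; apply/subsetP => x /cubeP ax; apply/cubeP => i.
by have [k kl xk] := ax i; exists k => //; apply: leq_trans ll.
Qed.

Lemma supported_enclosable y E :
  supported [set y] tau (letters E) -> enclosable (Defs.support E) Ltqo.
Proof.
move=> /supportE yE; have [a ya] := ball_cube y tau; exists a.
apply/subsetP => x /yE[z]; rewrite inE => /eqP-> /ya.
exact: (subsetP (cube_mono _ tau_le)).
Qed.

Lemma neutral_local y u : supported [set y] tau u -> neutral Ltqo (syndrome u).
Proof.
move=> yu; exists (Pauli 0%R u); split; last by rewrite defectsE.
exact: (@supported_enclosable y).
Qed.

Lemma stab_local y u : tqo_local_stabilizer H Ltqo ->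
  supported [set y] tau u -> syndrome u = set0 -> stab u.
Proof.
move=> tqo yu u0; apply/(stabP (Pauli 0%R u)); apply: tqo.
  by rewrite defectsE.
exact: (@supported_enclosable y).
Qed.

Lemma region_dist y r S :
  (forall b, b \in S -> dist y (term_cell b) <= r) ->
  forall x, x \in cluster_region S -> dist y x <= r.+1.
Proof.
move=> Sr x /bigcupP[b /Sr yb /elementary_cube_dist bx].
by have := dist_tri y (term_cell b) x; lia.
Qed.

(** The cells of [S] fit into a cube of size [2 * r.+1 + 1], so the smallest cube has diameter at
    most [2 * r + 2]; [ball 1] adds 1. *)
Lemma neutral_creation S a r : tqo_neutral_cluster H Ltqo ->
  neutral Ltqo S -> a \in S ->
  (forall b, b \in S -> dist (term_cell a) (term_cell b) <= r) ->
  exists2 u, syndrome u = S & supported [set term_cell a] (2 * r + 3) u.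
Proof.
move=> tqo /tqo[c [l [E [[Sc lmin] ES /subsetP Ec]]]] Sa Sr.
exists (letters E); first by rewrite -defectsE.
apply/supportE => x /Ec; rewrite inE => /existsP[z /andP[zc zx]].
exists (term_cell a); first by rewrite inE.
have ac : term_cell a \in cube c l.
  by apply: (subsetP Sc); apply/bigcupP; exists a => //; apply: elementary_cube_id.
have [c' cc'] := ball_cube (term_cell a) r.+1.
have /lmin : enclosable (cluster_region S) (2 * r.+1 + 1).
  by exists c'; apply/subsetP => y /(region_dist Sr) /cc'.
have := dist_cube ac zc; have := dist_tri (term_cell a) z x; lia.
Qed.

(** The anchor cubes have size [rho = 2 * xi + 3], and passing from centres to arbitrary points
    costs [4 * xi + 4]. The factor [5 * A + 13] leaves [A.+1 * rho] between them, an aspect ratio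
    strictly above [alpha]. *)
Lemma no_string (R : realType) (alpha : R) A y u S1 S2 y1 y2 xi :
  (alpha <= A%:R)%R -> no_strings H Ltqo alpha -> 1 <= xi ->
  supported [set y] tau u -> syndrome u = S1 :|: S2 ->
  (forall b, b \in S1 -> dist y1 (term_cell b) <= xi) ->
  (forall b, b \in S2 -> dist y2 (term_cell b) <= xi) ->
  (5 * A + 13) * xi <= dist y1 y2 -> neutral Ltqo S1.
Proof.
move=> alphaA ns xi1 yu uS S1xi S2xi y12.
have [a1 ya1] := ball_cube y1 xi.+1; have [a2 ya2] := ball_cube y2 xi.+1.
set rho := 2 * xi.+1 + 1 in ya1 ya2.
have far x1 x2 : x1 \in cube a1 rho -> x2 \in cube a2 rho ->
    A.+1 * rho <= dist x1 x2.
  move=> x1a x2a.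
  have y1a : y1 \in cube a1 rho by apply: ya1; rewrite distxx.
  have y2a : y2 \in cube a2 rho by apply: ya2; rewrite distxx.
  have := dist_cube y1a x1a; have := dist_cube x2a y2a.
  have := dist_tri y1 x1 y2; have := dist_tri x1 x2 y2.
  have Axi : A <= A * xi by rewrite leq_pmulr.
  move: y12; rewrite /rho; lia.
have disj : [disjoint cube a1 rho & cube a2 rho].
  rewrite -setI_eq0; apply/set0Pn => -[x /setIP[x1 x2]].
  by have := far x x x1 x2; rewrite distxx /rho; lia.
have sub1 b : b \in S1 -> elementary_cube (term_cell b) \subset cube a1 rho.
  move=> bS; apply/subsetP => x xb; apply: ya1; apply: (region_dist S1xi).
  by apply/bigcupP; exists b.
have sub2 b : b \in S2 -> elementary_cube (term_cell b) \subset cube a2 rho.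
  move=> bS; apply/subsetP => x xb; apply: ya2; apply: (region_dist S2xi).
  by apply/bigcupP; exists b.
pose E := Pauli 0%R u.
have ES : defects E = S1 :|: S2 by rewrite defectsE.
have [] := @ns E a1 a2 rho (A.+1)%:R%R.
- split=> //; first exact: (@supported_enclosable y).
  rewrite ES; apply/bigcupsP => b; rewrite inE => /orP[/sub1|/sub2] bsub.
    by apply: subset_trans bsub _; apply: subsetUl.
  by apply: subset_trans bsub _; apply: subsetUr.
- move=> x1 x2 x1a x2a; rewrite -natrM ler_nat; exact: far.
- by apply: (le_lt_trans alphaA); rewrite ltr_nat.
suff -> : defects_inside (defects E) (cube a1 rho) = S1 by [].
apply/setP => b; rewrite inE ES inE; have [/sub1->//|_] := boolP (b \in S1).
apply/negP => /andP[/sub2 b2 b1].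
have bb := elementary_cube_id (term_cell b).
by move/disjointFr: disj => /(_ _ (subsetP b1 _ bb)); rewrite (subsetP b2).
Qed.

Lemma path_opS (s : seq (pauli (qubit H))) t :
  t < size s -> path_op s t.+1 = (nth 1%g s t * path_op s t)%g.
Proof. by move=> ts; rewrite /path_op (take_nth 1%g) // foldl_rcons. Qed.

Lemma path_op_single (s : seq (pauli (qubit H))) t :
  (forall E, E \in s -> single_qubit E) -> t < size s ->
  exists q0, forall q,
    (letters (path_op s t.+1) - letters (path_op s t))%R q != 0%R -> q = q0.
Proof.
move=> sgl ts; rewrite path_opS // lettersM addrK.
have [q0 [l [_ ->]]] := sgl _ (mem_nth 1%g ts).
by exists q0 => q; rewrite ffunE; case: (eqVneq q q0) => // _; rewrite eqxx.
Qed.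

Lemma low_energy_path (R : realType) (alpha : R) A m (s : seq (pauli (qubit H))) P :
  (alpha <= A%:R)%R -> (4 * (10 * (5 * A + 13) + 200)) ^ m <= Ltqo ->
  tqo_local_stabilizer H Ltqo -> tqo_neutral_cluster H Ltqo ->
  no_strings H Ltqo alpha -> error_path s P -> defects P = set0 ->
  (forall t, 1 <= t <= size s -> #|defects (path_op s t)| <= m) ->
  stabilizer_up_to_phase P.
Proof.
move=> alphaA scale tqo1 tqo2 ns [sgl sP] P0 low; apply/stabP.
set lam := 5 * A + 13 in scale *.
(* A [chain] has at least one step, so the empty path is treated apart. *)
have [s0|s_gt0] := posnP (size s).
  by rewrite -sP s0 /path_op take0 letters1; apply: stab0.
pose loc1 := localized (@dist D L) (@qubit_site D L H) (@term_cell D L H) syn stab 1.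
pose few := fun u => #|syndrome u| <= m.
have single t : t < size s ->
    loc1 (letters (path_op s t)) (letters (path_op s t.+1)).
  move=> /(path_op_single sgl)[q0 q0P].
  exact: (localized_single (@distxx D L) syn_sub syn_local stab0
    (fun y u => @stab_local y u tqo1) q0P).
have ch n : forall t, t + n.+1 = size s -> chain loc1 few (letters (path_op s t)) (letters P).
  elim: n => [|n IH] t tn.
    by apply: chain1; rewrite -sP -tn addn1; apply: single; lia.
  apply: (@chainS _ _ _ _ _ (letters (path_op s t.+1))).
  - by apply: single; lia.
  - by rewrite /few -defectsE; apply: low; lia.
  - by apply: IH; lia.
have {ch} := ch (size s).-1 0 (prednK s_gt0); rewrite /path_op take0 letters1 => chP.
rewrite -[letters P]subr0.
apply: (low_energy_stab (@distxx D L) (@distC D L) (@dist_tri D L) syn_sub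
    syn_local stab0 stab_sub syn_stab neutral_local (fun y u => @stab_local y u tqo1)
    (fun S a r => @neutral_creation S a r tqo2) (lam := lam) (m := m) _ _ _ chP).
- by rewrite /lam; lia.
- by move=> y u S1 S2 y1 y2 xi; apply: no_string ns.
(* The separation at scale [q] is a quarter of [ratio ^ q.+1], hence at most [Ltqo / 4], which is at
   most [tau]. *)
- move=> q qm; have : (4 * (10 * lam + 200)) ^ q.+1 <= Ltqo.
    by apply: leq_trans scale; rewrite leq_exp2l; lia.
  rewrite expnS; have : 0 < (4 * (10 * lam + 200)) ^ q by rewrite expn_gt0; lia.
  move: (_ ^ q) => K K0 KL; have := odd_double_half Ltqo.-1.
  nia.
- by apply/setP => a; rewrite !inE (syn_stab a stab0).
- by rewrite -defectsE.
Qed.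

End Code.

Theorem theorem1 : forall (R : realType) (D : nat) (alpha beta : R),
  (1 <= D)%N -> (1 <= alpha)%R -> (0 < beta)%R ->
  exists c : R, (0 < c)%R /\
    forall (L : nat) (H : stabilizer_hamiltonian D L) (Ltqo : nat),
      (0 < L)%N ->
      (powR L%:R beta <= Ltqo%:R)%R ->
      tqo_local_stabilizer H Ltqo ->
      tqo_neutral_cluster H Ltqo ->
      no_strings H Ltqo alpha ->
      forall P : pauli (qubit H), logical_operator P ->
        energy_barrier P (c * ln L%:R)%R.
Proof.
move=> R D alpha beta _ alpha1 beta0.
have /archi_boundP := le_trans ler01 alpha1.
set A := Num.bound alpha => /ltW alphaA.
pose K := 4 * (10 * (5 * A + 13) + 200).
have lnK : (0 < ln K%:R :> R)%R by rewrite ln_gt0 // ltr1n /K; lia.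
(* With this constant, [m <= c * ln L] gives [K ^ m <= L ^ beta <= Ltqo]. *)
exists (beta / ln K%:R)%R; split; first exact: divr_gt0.
move=> L H Ltqo L0 LLtqo tqo1 tqo2 ns P [Pcomm Plog] s sP.
have lnL : (0 <= ln L%:R :> R)%R by rewrite ln_ge0 // ler1n.
set w := (beta / ln K%:R * ln L%:R)%R.
have w0 : (0 <= w)%R by rewrite mulr_ge0 // divr_ge0 // ltW.
have /andP[mw wm] := truncn_itv w0; set m := Num.truncn w in mw wm.
have KL : K ^ m <= Ltqo.
  rewrite -(ler_nat R); apply: le_trans LLtqo.
  have K0 : (0 < K%:R :> R)%R by rewrite ltr0n /K; lia.
  rewrite natrX -powR_mulrn ?(ltW K0) // /powR !gt_eqF ?ltr0n // ler_expR.
  by rewrite -ler_pdivlMr // mulrAC.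
have Ltqo0 : 0 < Ltqo by apply: leq_trans KL; rewrite expn_gt0; apply/orP; left; rewrite /K; lia.
apply: contrapT => low; apply: Plog.
apply: (low_energy_path Ltqo0 alphaA KL tqo1 tqo2 ns sP).
  apply/setP => a; rewrite !inE anticommuteE; apply: commute_anti.
  by apply: commute_sym; apply: Pcomm; apply: mem_gen; apply: imset_f.
(* Defect counts are integers, so not exceeding [w < m + 1] means being at most [m]. *)
move=> t ts; rewrite -ltnS -(ltr_nat R); apply: le_lt_trans wm.
by rewrite leNgt; apply/negP => wt; apply: low; exists t.
Qed.
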